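(* Let $M_k$ denote a matching with $k$ edges. Then \[ \mathrm{ex}^*(n,M_k)=n(k-1)+O(k^2), \] where the implied constant is absolute, i.e. independent of $n$ and $k$.
   Context: For a fixed graph $F$, $\mathrm{ex}^*(n,F)$ (the rainbow Turán number of $F$) is the maximum number of edges in a graph on $n$ vertices that admits a proper edge-coloring containing no rainbow copy of $F$. A rainbow copy of $F$ is a copy of $F$ all of whose edges receive different colors. *)

(* Defs.v *)
From HB Require Import structures.
From mathcomp Require Import all_boot all_order all_algebra.
From mathcomp Require Import boolp.

Set Implicit Arguments.
Unset Strict Implicit.
Unset Printing Implicit Defensive.

Record sgraph (T : finType) := SGraph {
  edges :> {set {set T}};
  edges_card2 : [forall e in edges, #|e| == 2] }.

HB.instance Definition _ (T : finType) := [isSub for @edges T].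
HB.instance Definition _ (T : finType) := [Finite of sgraph T by <:].

(* Colours are arbitrary naturals, so the number of colours is not bounded;
   the values of [c] outside [edges G] are irrelevant. *)
Definition proper_edge_coloring (T : finType) (G : sgraph T)
    (c : {set T} -> nat) : Prop :=
  forall e1 e2 : {set T}, e1 \in edges G -> e2 \in edges G ->
    e1 != e2 -> e1 :&: e2 != set0 -> c e1 <> c e2.

(* A copy of [F] in [G] is given by an injection [f] of vertices, not
   necessarily induced. *)
Definition has_rainbow_copy (U T : finType) (F : sgraph U) (G : sgraph T)
    (c : {set T} -> nat) : Prop :=
  exists f : U -> T,
    [/\ injective f,
        forall e : {set U}, e \in edges F -> f @: e \in edges G
      & {in edges F &, injective (fun e : {set U} => c (f @: e))}].

Definition rainbow_free_colorable (U T : finType) (F : sgraph U)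
    (G : sgraph T) : Prop :=
  exists c : {set T} -> nat,
    proper_edge_coloring G c /\ ~ has_rainbow_copy F G c.

(* The rainbow Turan number. If [F] has an edge then the edgeless graph is
   admissible, so this is a genuine maximum; the value 0 of an empty [\max]
   can only arise for edgeless [F]. *)
Definition ex_star (n : nat) (U : finType) (F : sgraph U) : nat :=
  \max_(G : sgraph 'I_n | `[< rainbow_free_colorable F G >]) #|edges G|.

Definition matching_edge (k : nat) (i : 'I_k) : {set 'I_k * bool} :=
  [set (i, false); (i, true)].

Lemma matching_card2 (k : nat) :
  [forall e in [set matching_edge i | i : 'I_k], #|e| == 2].
Proof. by apply/forall_inP => _ /imsetP[i _ ->]; rewrite cards2 xpair_eqE andbF. Qed.

Definition matching (k : nat) : sgraph ('I_k * bool)%type :=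
  SGraph (matching_card2 k).

(* Main.v *)
(** Upper bound, by induction on the size [k] of the largest rainbow matching.
    A rainbow matching that avoids a vertex [v] of degree more than [3k] can be
    extended by an edge at [v], so deleting [v] costs at most [n] edges and
    lowers [k].  If all degrees are at most [3k], then every edge meets one of
    the at most [2k] vertices of a maximum rainbow matching or has one of its at
    most [k] colours, and a colour class has at most [n] edges.
    Lower bound: the graph of all edges meeting a fixed set of [k - 1] vertices
    has no matching with [k] edges. *)
Require Import Defs.
From mathcomp Require Import all_boot all_order all_algebra.
From mathcomp Require Import boolp zify.
Import Order.TTheory GRing.Theory Num.Theory.

Set Implicit Arguments.
Unset Strict Implicit.
Unset Printing Implicit Defensive.

(** * Union bound, degrees and codegrees *)

Lemma leq_card_bigcup (I T : finType) (A : {set I}) (F : I -> {set T}) (b : nat) :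
  {in A, forall i, #|F i| <= b} -> #|\bigcup_(i in A) F i| <= #|A| * b.
Proof.
move=> leFb; rewrite -sum_nat_const.
have : #|\bigcup_(i in A) F i| <= \sum_(i in A) #|F i|.
  elim/big_rec2: _ => [|i s B _ leBs]; first by rewrite cards0.
  by apply: leq_trans (leq_card_setU _ _) _; rewrite leq_add2l.
by move/leq_trans; apply; apply: leq_sum => i /leFb.
Qed.

Section Edges.

Variables (T : finType) (E : {set {set T}}).
Hypothesis E2 : {in E, forall e : {set T}, #|e| = 2}.

Lemma edge_at (e : {set T}) (v : T) :
  e \in E -> v \in e -> exists2 w, w != v & e = [set v; w].
Proof.
move=> /E2 /eqP /cards2P [x [y [neq_xy ->]]]; rewrite !inE => /orP[] /eqP->.
  by exists y; rewrite // eq_sym.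
by exists x; rewrite // setUC.
Qed.

Lemma leq_degree (v : T) : #|[set e in E | v \in e]| <= #|T|.
Proof.
apply: leq_trans (leq_imset_card (fun w => [set v; w]) T).
apply/subset_leq_card/subsetP => e; rewrite inE => /andP[eE ve].
by have [w _ ->] := edge_at eE ve; apply: imset_f.
Qed.

Lemma leq_codegree (v w : T) : w != v ->
  #|[set e in [set e in E | v \in e] | w \in e]| <= 1.
Proof.
move=> neq_wv; rewrite -(cards1 [set v; w]).
apply/subset_leq_card/subsetP => e; rewrite !inE => /andP[/andP[eE ve] we].
have [u _ def_e] := edge_at eE ve; move: we.
by rewrite def_e !inE (negPf neq_wv) /= => /eqP->.
Qed.

End Edges.

(** * Rainbow matchings and the upper bound *)

Section Rainbow.

Variables (T : finType) (c : {set T} -> nat).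
Implicit Types (E M X : {set {set T}}) (e : {set T}) (v w : T).

Definition proper E :=
  {in E &, forall e1 e2, e1 != e2 -> e1 :&: e2 != set0 -> c e1 <> c e2}.

(** Rainbow matchings are handled as edge sets, which suits counting; [rainbow_copy] recovers the
    vertex injection. *)
Definition rainbow M := trivIset M /\ {in M &, injective c}.

Lemma rainbow0 : rainbow set0.
Proof.
split; last by move=> e1 e2; rewrite inE.
by apply/trivIsetP => e1 e2; rewrite inE.
Qed.

Lemma card_cover_leq M : {in M, forall e, #|e| = 2} -> #|cover M| <= #|M| * 2.
Proof. by move=> M2; apply: leq_card_bigcup => e /M2 ->. Qed.

(** Properness makes edges of one colour pairwise disjoint, so their sizes add up to at most the
    number of vertices. *)
Lemma leq_color_class E a :
  {in E, forall e, #|e| = 2} -> proper E ->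
  #|[set e in E | c e == a]| <= #|T|.
Proof.
move=> E2 propE; set P := [set e in E | c e == a].
have trivP : trivIset P.
  apply/trivIsetP => e1 e2; rewrite !inE => /andP[e1E /eqP c1] /andP[e2E /eqP c2].
  move=> neq12; rewrite -setI_eq0; apply: contraT => meet12.
  by have [] := propE _ _ e1E e2E neq12 meet12; rewrite c1 c2.
apply: leq_trans (max_card [in cover P]); rewrite -(eqP trivP) -sum1_card.
by apply: leq_sum => e; rewrite inE => /andP[/E2 -> _].
Qed.

Lemma leq_color_degree E v a : proper E ->
  #|[set e in [set e in E | v \in e] | c e == a]| <= 1.
Proof.
move=> propE; apply/card_le1_eqP => e1 e2; rewrite !inE.
move=> /andP[/andP[e1E ve1] /eqP c1] /andP[/andP[e2E ve2] /eqP c2].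
apply/eqP; apply: contraT => neq12; have [] := propE _ _ e2E e1E neq12.
  by apply/set0Pn; exists v; rewrite inE ve2.
by rewrite c1 c2.
Qed.

Lemma rainbow_setU1 M e :
  rainbow M -> e != set0 -> [disjoint e & cover M] ->
  {in M, forall m, c e != c m} -> rainbow (e |: M).
Proof.
move=> [trivM injM] nz_e dis_e col_e; split.
  have dis m : m \in M -> [disjoint e & m].
    by move=> mM; apply: disjointWr dis_e; apply: bigcup_sup.
  apply/trivIsetP => e1 e2; rewrite !inE.
  move=> /predU1P[->|e1M] /predU1P[->|e2M] neq12; first by rewrite eqxx in neq12.
  - exact: dis.
  - by rewrite disjoint_sym dis.
  - exact: (trivIsetP trivM).
move=> e1 e2; rewrite !inE => /predU1P[->|e1M] /predU1P[->|e2M] //.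
- by move=> eq_c; have := col_e _ e2M; rewrite eq_c eqxx.
- by move=> eq_c; have := col_e _ e1M; rewrite eq_c eqxx.
- exact: injM.
Qed.

(** An edge of [X] is bad if it meets one of the at most [2 * #|M|] vertices of [M] (set [B]) or
    repeats one of its [#|M|] colours (set [C]). Too few edges are bad to exhaust [X]. Used both for
    the star at a vertex and for all edges. *)
Lemma rainbow_extend M X (d1 d2 : nat) :
  rainbow M -> {in M, forall e, #|e| = 2} -> {in X, forall e, #|e| = 2} ->
  {in cover M, forall w, #|[set e in X | w \in e]| <= d1} ->
  (forall a, #|[set e in X | c e == a]| <= d2) ->
  #|M| * (2 * d1 + d2) < #|X| ->
  exists2 e, e \in X & rainbow (e |: M) /\ #|e |: M| = #|M|.+1.
Proof.
move=> rbM M2 X2 ledeg lecol ltMX.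
pose B := \bigcup_(w in cover M) [set e in X | w \in e].
pose C := \bigcup_(m in M) [set e in X | c e == c m].
have leBC : #|B :|: C| <= #|M| * (2 * d1 + d2).
  apply: leq_trans (leq_card_setU _ _) _.
  rewrite mulnDr mulnA leq_add ?leq_card_bigcup //.
  apply: leq_trans (leq_card_bigcup ledeg) _.
  by rewrite leq_mul2r card_cover_leq ?orbT.
have /subsetPn[e eX] : ~~ (X \subset B :|: C).
  by apply/negP => /subset_leq_card; lia.
rewrite inE negb_or => /andP[eNB eNC]; exists e => //.
have dis_e : [disjoint e & cover M].
  apply/pred0Pn => -[w /andP[/= we wM]]; case/bigcupP: eNB.
  by exists w; rewrite // inE eX.
have col_e : {in M, forall m, c e != c m}.
  move=> m mM; apply: contra eNC => eq_c; apply/bigcupP.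
  by exists m; rewrite // inE eX.
split; first by apply: rainbow_setU1; rewrite // -card_gt0 X2.
by rewrite cardsU1; case: (boolP (e \in M)) => // /col_e /[!eqxx].
Qed.

Lemma card_edges_leq E (k : nat) :
  {in E, forall e, #|e| = 2} -> proper E ->
  (forall M, M \subset E -> rainbow M -> #|M| <= k) ->
  #|E| <= #|T| * k + 6 * k ^ 2.
Proof.
elim: k E => [|k IHk] E E2 propE maxE.
  rewrite muln0 leqn0 cards_eq0; apply/eqP/setP => e; rewrite inE.
  apply/negP => eE; suff /maxE : rainbow [set e] by rewrite sub1set cards1 => /(_ eE).
  split; last by move=> e1 e2 /set1P-> /set1P->.
  by apply/trivIsetP => e1 e2 /set1P-> /set1P->; rewrite eqxx.
have [/existsP[v deg_v]|] :=
    boolP [exists v, 3 * k.+1 < #|[set e in E | v \in e]|].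
  pose E' := [set e in E | v \notin e].
  have sE'E : E' \subset E by apply/subsetP => e /setIdP[].
  (* A rainbow matching of [k.+1] edges avoiding [v] would extend by an edge at [v] to one of [k.+2]
     edges, against [maxE]. *)
  have leE' : #|E'| <= #|T| * k + 6 * k ^ 2.
    apply: IHk => [e /(subsetP sE'E)/E2 //|e1 e2|M sME' rbM].
      by move=> /(subsetP sE'E) ? /(subsetP sE'E); apply: propE.
    have sME := subset_trans sME' sE'E.
    have leM := maxE M sME rbM.
    rewrite leqNgt; apply/negP => ltkM.
    (* In the star at [v], a vertex other than [v] lies on at most one edge and each colour occurs
       at most once, so [d1 = d2 = 1] and at most [3 * #|M|] edges are bad. *)
    have [||w /bigcupP[m mM wm]|a||e] := @rainbow_extend M
      [set e in E | v \in e] 1 1 rbM.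
    - by move=> m /(subsetP sME)/E2.
    - by move=> e /setIdP[/E2].
    - apply: leq_codegree => //; apply: contraL wm => /eqP->.
      by have /setIdP[] := subsetP sME' m mM.
    - exact: leq_color_degree.
    - by lia.
    move=> /setIdP[eE _] [rbeM cardeM].
    have := maxE (e |: M); rewrite cardeM subUset sub1set eE sME.
    by move=> /(_ isT rbeM); lia.
  have leE : #|E| <= #|[set e in E | v \in e]| + #|E'|.
    apply: leq_trans (leq_card_setU _ _); apply/subset_leq_card/subsetP => e eE.
    by rewrite !inE eE; case: (v \in e).
  by have := leq_degree E2 v; nia.
rewrite negb_exists => /forallP deg; rewrite leqNgt; apply/negP => ltE.
(* With small degrees, greedy extension inside [E] reaches [k.+2] edges, one more than [maxE]
   allows. *)
have grow j : j <= k.+2 -> exists M, [/\ M \subset E, rainbow M & #|M| = j].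
  elim: j => [_|j IHj ltj].
    by exists set0; rewrite sub0set cards0; split => //; apply: rainbow0.
  have [M [sME rbM cardM]] := IHj (ltnW ltj).
  have [||w _|a||e eE [rbeM cardeM]] :=
    @rainbow_extend M E (3 * k.+1) #|T| rbM.
  - by move=> m /(subsetP sME)/E2.
  - exact: E2.
  - by rewrite leqNgt.
  - exact: leq_color_class.
  (* Here [j <= k.+1], so the bad edges number at most [k.+1 * (6 * k.+1 + #|T|)]; this is where the
     constant 6 comes from. *)
  - by rewrite cardM; nia.
  by exists (e |: M); rewrite subUset sub1set eE sME cardeM cardM.
have [M [sME rbM cardM]] := grow _ (leqnn _).
by have := maxE M sME rbM; rewrite cardM ltnn.
Qed.

(** The first [k] edges in the enumeration of [M] are used, each with an arbitrarily chosen order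
    [p] of its endpoints. Disjointness of the edges makes the vertex map injective. *)
Lemma rainbow_copy (G : sgraph T) M (k : nat) :
  M \subset edges G -> rainbow M -> k <= #|M| ->
  has_rainbow_copy (matching k) G c.
Proof.
move=> sMG [trivM injM] lekM.
pose m (i : 'I_k) := enum_val (widen_ord lekM i).
have mM i : m i \in M by apply: enum_valP.
have inj_m : injective m.
  by move=> i j /enum_val_inj /(congr1 val) /= /val_inj.
have ends i : exists p : T * T, (p.1 != p.2) && (m i == [set p.1; p.2]).
  have /(forall_inP (edges_card2 G)) := subsetP sMG _ (mM i).
  by case/cards2P => x [y [neq_xy ->]]; exists (x, y); rewrite neq_xy eqxx.
pose p i := xchoose (ends i).
have neqp i : (p i).1 != (p i).2 by have /andP[] := xchooseP (ends i).
have defm i : m i = [set (p i).1; (p i).2].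
  by have /andP[_ /eqP] := xchooseP (ends i).
pose f (u : 'I_k * bool) := if u.2 then (p u.1).2 else (p u.1).1.
have f_m u : f u \in m u.1 by rewrite defm /f !inE; case: u.2; rewrite eqxx ?orbT.
have f_edge i : f @: matching_edge i = m i.
  by rewrite /matching_edge imsetU1 imset_set1 defm.
exists f; split.
- move=> [i a] [j b] eq_f.
  have eq_ij : i = j.
    apply: inj_m; apply/eqP; apply: contraT => neq_m.
    have dis_m := trivIsetP trivM _ _ (mM i) (mM j) neq_m.
    by have := disjointFr dis_m (f_m (i, a)); rewrite eq_f (f_m (j, b)).
  move: eq_f; rewrite -eq_ij /f /=.
  by case: a b => -[] // /eqP; rewrite ?(negPf (neqp i)) // eq_sym (negPf (neqp i)).
- by move=> _ /imsetP[i _ ->]; rewrite f_edge (subsetP sMG).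
- move=> _ _ /imsetP[i _ ->] /imsetP[j _ ->].
  by rewrite !f_edge => /(injM _ _ (mM i) (mM j)) /inj_m ->.
Qed.

End Rainbow.

Lemma ex_star_matching_leq (n k : nat) :
  ex_star n (matching k.+1) <= n * k + 6 * k ^ 2.
Proof.
apply/bigmax_leqP => G /asboolP[c [propG freeG]].
rewrite -[n in n * k]card_ord; apply: (@card_edges_leq _ c).
- by move=> e /(forall_inP (edges_card2 G))/eqP.
- by move=> e1 e2; apply: propG.
- move=> M sMG rbM; rewrite leqNgt; apply/negP => ltkM.
  by apply: freeG; apply: rainbow_copy rbM ltkM.
Qed.

(** * The lower bound construction *)

Section MeetingGraph.

Variables (T : finType) (A : {set T}).

Definition meeting_edges : {set {set T}} :=
  [set e : {set T} | (#|e| == 2) && ~~ [disjoint e & A]].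

Lemma meeting_card2 : [forall e in meeting_edges, #|e| == 2].
Proof. by apply/forall_inP => e; rewrite inE => /andP[]. Qed.

Definition meeting_graph := SGraph meeting_card2.

(** Colouring by [pickle] gives all edges distinct colours, so every copy is rainbow and none may
    exist at all: [k] disjoint edges would each need their own vertex of [A]. *)
Lemma meeting_graph_free (k : nat) : #|A| < k ->
  rainbow_free_colorable (matching k) meeting_graph.
Proof.
move=> ltAk; exists pickle; split.
  move=> e1 e2 _ _ neq12 _ /(pcan_inj pickleK) eq12.
  by rewrite eq12 eqxx in neq12.
case=> f [inj_f edge_f _].
have hit i : exists b, f (i, b) \in A.
  have /edge_f : matching_edge i \in edges (matching k) by apply: imset_f.
  rewrite inE => /andP[_ /pred0Pn[x /andP[/= /imsetP[u]]]].
  by rewrite !inE => /orP[] /eqP-> -> xA; [exists false | exists true].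
pose g i := f (i, xchoose (hit i)).
have inj_g : injective g by move=> i j /inj_f [].
have : #|g @: 'I_k| <= #|A|.
  apply/subset_leq_card/subsetP => _ /imsetP[i _ ->].
  exact: (xchooseP (hit i)).
by rewrite card_imset // card_ord leqNgt ltAk.
Qed.

(** Only edges between [A] and its complement are counted; such an edge determines which endpoint
    lies in [A]. Dropping the edges inside [A] is harmless for the error term. *)
Lemma card_meeting_edges : #|A| * #|~: A| <= #|meeting_edges|.
Proof.
rewrite -cardsX.
have inj_h : {in setX A (~: A) &, injective (fun u : T * T => [set u.1; u.2])}.
  move=> [a b] [a' b']; rewrite !inE /= => /andP[aA bA] /andP[a'A b'A] eq_ab.
  have : a \in [set a'; b'] by rewrite -eq_ab !inE eqxx.
  have : b \in [set a'; b'] by rewrite -eq_ab !inE eqxx orbT.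
  rewrite !inE => /orP[] /eqP eb /orP[] /eqP ea.
  - by rewrite eb a'A in bA.
  - by rewrite eb a'A in bA.
  - by rewrite ea eb.
  - by rewrite -ea aA in b'A.
rewrite -(card_in_imset inj_h).
apply/subset_leq_card/subsetP => _ /imsetP[[a b] + ->].
rewrite !inE /= => /andP[aA bA]; rewrite cards2.
have -> /= : a != b by apply: contraNneq bA => <-.
by apply/pred0Pn; exists a; rewrite /= !inE eqxx aA.
Qed.

End MeetingGraph.

Lemma ex_star_matching_geq (n k : nat) :
  n * k <= ex_star n (matching k.+1) + k ^ 2.
Proof.
(* For [n <= k] the term [k ^ 2] alone suffices; otherwise [A] has room for [k] vertices. *)
have [lenk|/ltnW lekn] := leqP n k; first by nia.
pose A := [set widen_ord lekn i | i : 'I_k].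
have cardA : #|A| = k.
  by rewrite card_imset ?card_ord // => i j /(congr1 val) /= /val_inj.
have : #|A| * #|~: A| <= ex_star n (matching k.+1).
  apply: leq_trans (card_meeting_edges A) _.
  apply: (leq_bigmax_cond (meeting_graph A)).
  by apply/asboolP/meeting_graph_free; rewrite cardA.
by have := cardsC A; rewrite cardA card_ord; nia.
Qed.

Local Open Scope ring_scope.

Theorem theorem1 :
  exists C : nat, forall n k : nat, (1 <= k)%N ->
    `| (ex_star n (matching k))%:Z - n%:Z * (k%:Z - 1) | <= C%:Z * k%:Z ^+ 2.
Proof.
(* From here [k] is the predecessor of the matching size; the errors [k ^ 2] below and [6 * k ^ 2]
   above are both at most 6 times the square of [k.+1]. *)
exists 6%N => n [//|k] _.
have := ex_star_matching_leq n k; have := ex_star_matching_geq n k.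
move: (ex_star _ _) => x; rewrite ler_norml => ? ?.
by apply/andP; split; nia.
Qed.
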